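(* Let $K$ be a field and let $(X,\sigma)$ be a Deaconu--Renault system with $X$ totally disconnected. The following are equivalent: (1) $X$ is finite; (2) $A_K(G(X,\sigma))$ is locally finite (for its standard $\mathbb Z$-grading); (3) $A_K(G(X,\sigma))$ is Noetherian.
   Context: A Deaconu--Renault system is a pair $(X,\sigma)$ where $X$ is a locally compact Hausdorff space and $\sigma:\operatorname{dom}(\sigma)\to X$ is a local homeomorphism defined on an open subset $\operatorname{dom}(\sigma)\subseteq X$. Set $\operatorname{dom}(\sigma^0)=X$, $\sigma^0=\mathrm{id}_X$, $\operatorname{dom}(\sigma^{n+1})=\{x\in\operatorname{dom}(\sigma^n):\sigma^n(x)\in\operatorname{dom}(\sigma)\}$ and $\sigma^{n+1}(x)=\sigma(\sigma^n(x))$. The Deaconu--Renault groupoid is $G(X,\sigma)=\{(x,k,y)\in X\times\mathbb Z\times X:\exists\, m,n\ge0,\ k=m-n,\ x\in\operatorname{dom}(\sigma^m),\ y\in\operatorname{dom}(\sigma^n),\ \sigma^m(x)=\sigma^n(y)\}$, with $r(x,k,y)=x$, $s(x,k,y)=y$, $(x,k,y)(y,\ell,z)=(x,k+\ell,z)$, $(x,k,y)^{-1}=(y,-k,x)$, unit space identified with $X$ via $x\leftrightarrow(x,0,x)$, and topology generated by the sets $Z(U,m,n,V)=\{(x,m-n,y): x\in U,\ y\in V,\ \sigma^m(x)=\sigma^n(y)\}$, with $m,n\ge0$ and $U\subseteq\operatorname{dom}(\sigma^m)$, $V\subseteq\operatorname{dom}(\sigma^n)$ open such that $\sigma^m|_U$,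 $\sigma^n|_V$ are homeomorphisms onto their images. When $X$ is totally disconnected this is an ample Hausdorff groupoid. The Steinberg algebra of an ample Hausdorff groupoid $G$ is $A_K(G)=\mathrm{span}_K\{1_U:U\subseteq G\text{ a compact open bisection}\}$ with convolution product, determined by $1_U*1_V=1_{UV}$ (a bisection is a set on which $r$ and $s$ are injective). The standard $\mathbb Z$-grading of $A_K(G(X,\sigma))$ is induced by $c(x,k,y)=k$: the degree-$k$ component is $\mathrm{span}_K\{1_U:U\subseteq c^{-1}(k)\text{ a compact open bisection}\}$. Locally finite means every homogeneous component is finite-dimensional over $K$. Noetherian means the ascending chain condition on one-sided ideals (left and right conditions are equivalent here, since inversion in the groupoid induces an anti-automorphism of the algebra). *)

(* Defs.v *)
From HB Require Import structures.
From mathcomp Require Import all_boot all_order all_algebra.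
From mathcomp Require Import zify.
From mathcomp Require Import all_classical all_reals all_analysis.

Set Implicit Arguments.
Unset Strict Implicit.
Unset Printing Implicit Defensive.

Import GRing.Theory.
Local Open Scope classical_set_scope.
Local Open Scope ring_scope.

(** * Linear algebra *)

Definition lspan (K : fieldType) (E : lmodType K) (S : set E) : set E :=
  [set v | exists (n : nat) (a : 'I_n -> K) (e : 'I_n -> E),
     (forall i, S (e i)) /\ v = \sum_(i < n) a i *: e i].

Definition finite_dimensional (K : fieldType) (E : lmodType K) (V : set E) :=
  exists2 B : set E, finite_set B & V = lspan B.

(** * One-sided ideals of a possibly non-unital ring

The ring has carrier the additive subgroup [A] of [E] and multiplication the
restriction of [mul] to [A]. *)

Section Ideals.
Context {E : zmodType} (A : set E) (mul : E -> E -> E).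

Definition left_ideal (I : set E) :=
  [/\ I `<=` A, I 0, (forall a b, I a -> I b -> I (a - b))
    & forall a b, A a -> I b -> I (mul a b)].

Definition right_ideal (I : set E) :=
  [/\ I `<=` A, I 0, (forall a b, I a -> I b -> I (a - b))
    & forall a b, I a -> A b -> I (mul a b)].

Definition ascending_chain_condition (P : set (set E)) :=
  forall I : nat -> set E, (forall n, P (I n)) ->
    (forall n, I n `<=` I n.+1) ->
    exists N, forall n, (N <= n)%N -> I n = I N.

Definition left_noetherian := ascending_chain_condition left_ideal.
Definition right_noetherian := ascending_chain_condition right_ideal.

End Ideals.

(** * Groupoids and Steinberg algebras *)

(* [gmul a b e] is the product [a b], defined when the source of [a] is the
   range of [b]. *)
Record groupoid (X G : Type) := Groupoid {
  grng : G -> X;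
  gsrc : G -> X;
  gunit : X -> G;
  ginv : G -> G;
  gmul : forall a b : G, gsrc a = grng b -> G;
  grng_unit : forall x, grng (gunit x) = x;
  gsrc_unit : forall x, gsrc (gunit x) = x;
  grng_inv : forall a, grng (ginv a) = gsrc a;
  gsrc_inv : forall a, gsrc (ginv a) = grng a;
  grng_mul : forall a b (e : gsrc a = grng b), grng (gmul e) = grng a;
  gsrc_mul : forall a b (e : gsrc a = grng b), gsrc (gmul e) = gsrc b;
  gmulA : forall a b c (eab : gsrc a = grng b) (ebc : gsrc b = grng c)
      (e1 : gsrc (gmul eab) = grng c) (e2 : gsrc a = grng (gmul ebc)),
    gmul e1 = gmul e2;
  gmul1 : forall a (e : gsrc (gunit (grng a)) = grng a), gmul e = a;
  gmulx1 : forall a (e : gsrc a = grng (gunit (gsrc a))), gmul e = a;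
  gmulV : forall a (e : gsrc (ginv a) = grng a), gmul e = gunit (gsrc a);
  gmulxV : forall a (e : gsrc a = grng (ginv a)), gmul e = gunit (grng a)
}.

Section Steinberg.
Context (K : fieldType) {X : Type} {G : topologicalType} (gG : groupoid X G).

Definition compact_open_bisection (U : set G) :=
  [/\ compact U, open U, set_inj U (grng gG) & set_inj U (gsrc gG)].

(* Functions take values in [K^o] so that they form an [lmodType K]. *)
Definition steinberg_algebra : set (G -> K^o) :=
  lspan [set \1_U | U in compact_open_bisection].

(* A finitely supported sum whenever [f] and [g] lie in [steinberg_algebra]. *)
Definition convolution (f g : G -> K^o) : G -> K^o := fun c =>
  \sum_(p \in [set p : G * G |
                exists e : gsrc gG p.1 = grng gG p.2, gmul e = c])
    (f p.1 * g p.2).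

Definition steinberg_component (deg : G -> int) (k : int) : set (G -> K^o) :=
  lspan [set \1_U | U in
           [set U | compact_open_bisection U /\ U `<=` [set a | deg a = k]]].

Definition steinberg_locally_finite (deg : G -> int) :=
  forall k : int, finite_dimensional (steinberg_component deg k).

Definition steinberg_left_noetherian :=
  left_noetherian steinberg_algebra convolution.

Definition steinberg_right_noetherian :=
  right_noetherian steinberg_algebra convolution.

End Steinberg.

(** * Deaconu-Renault systems *)

Definition homeo_onto_image {X Y : topologicalType} (U : set X) (f : X -> Y) :=
  {within U, continuous f} /\
  exists2 g : Y -> X, {within f @` U, continuous g} & {in U, cancel f g}.

Definition local_homeomorphism_on {X Y : topologicalType} (D : set X)
    (f : X -> Y) :=
  forall x, D x -> exists U : set X,
    [/\ open U, U x, U `<=` D, open (f @` U) & homeo_onto_image U f].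

(* The partial map is the restriction of the total function [dr_map] to
   [dr_dom]; the values of [dr_map] elsewhere are irrelevant. *)
Record dr_system (X : topologicalType) := DRSystem {
  dr_hausdorff : hausdorff_space X;
  dr_locally_compact : locally_compact [set: X];
  dr_dom : set X;
  dr_map : X -> X;
  dr_dom_open : open dr_dom;
  dr_map_local_homeo : local_homeomorphism_on dr_dom dr_map
}.

Section DeaconuRenault.
Context {X : topologicalType} (S : dr_system X).
Local Notation sigma := (dr_map S).

Fixpoint dr_dom_iter (n : nat) : set X :=
  if n is m.+1 then [set x | dr_dom_iter m x /\ dr_dom S (iter m sigma x)]
  else setT.

Lemma dr_dom_iterD m n x :
  dr_dom_iter (m + n) x <-> dr_dom_iter m x /\ dr_dom_iter n (iter m sigma x).
Proof.
elim: n => [|n IH]; first by rewrite addn0; split=> [|[]].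
by rewrite addnS /= addnC iterD addnC; tauto.
Qed.

Definition dr_triples : set (X * int * X) :=
  [set t | exists m n : nat,
    [/\ t.1.2 = m%:Z - n%:Z, dr_dom_iter m t.1.1, dr_dom_iter n t.2
      & iter m sigma t.1.1 = iter n sigma t.2]].

Definition dr_groupoid_type : Type := set_type dr_triples.

HB.instance Definition _ := Choice.on dr_groupoid_type.

Local Notation G := dr_groupoid_type.

Definition dr_rng (a : G) : X := (val a).1.1.
Definition dr_deg (a : G) : int := (val a).1.2.
Definition dr_src (a : G) : X := (val a).2.

Definition dr_basic_set (U : set X) (m n : nat) (V : set X) : set G :=
  [set a | [/\ U (dr_rng a), V (dr_src a), dr_deg a = m%:Z - n%:Z
             & iter m sigma (dr_rng a) = iter n sigma (dr_src a)]].

Definition dr_basic_sets : set (set G) :=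
  [set B | exists (U V : set X) (m n : nat),
    [/\ [/\ open U, U `<=` dr_dom_iter m & homeo_onto_image U (iter m sigma)],
        [/\ open V, V `<=` dr_dom_iter n & homeo_onto_image V (iter n sigma)]
      & B = dr_basic_set U m n V]].

HB.instance Definition _ := isSubBaseTopological.Build G dr_basic_sets id.

Lemma dr_triples_unit x : (x, 0, x) \in dr_triples.
Proof. by rewrite inE; exists 0%N, 0%N. Qed.

Lemma dr_triples_inv a : (dr_src a, - dr_deg a, dr_rng a) \in dr_triples.
Proof.
rewrite inE; have [m [n [e dm dn eq]]] := set_mem (valP a).
by exists n, m; split=> //=; rewrite /dr_deg e opprB.
Qed.

Lemma dr_triples_mul a b : dr_src a = dr_rng b ->
  (dr_rng a, dr_deg a + dr_deg b, dr_src b) \in dr_triples.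
Proof.
rewrite inE /dr_deg /dr_src /dr_rng => eab.
have [m [n [-> dm dn mn]]] := set_mem (valP a).
have [k [l [-> dk dl kl]]] := set_mem (valP b).
have [nk|/ltnW kn] := leqP n k.
- exists (m + (k - n))%N, l; split=> //=.
  + by rewrite PoszD -subzn //; lia.
  + apply/dr_dom_iterD; split=> //; rewrite mn eab.
    by have [] := (dr_dom_iterD n (k - n) (val b).1.1).1; rewrite ?subnKC.
  + by rewrite addnC iterD mn eab -iterD subnK.
- exists m, (l + (n - k))%N; split=> //=.
  + by rewrite PoszD -subzn //; lia.
  + apply/dr_dom_iterD; split=> //; rewrite -kl.
    by have [] := (dr_dom_iterD k (n - k) (val a).2).1; rewrite ?subnKC -?eab.
  + by rewrite mn [(l + _)%N]addnC iterD -kl -eab -iterD subnK.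
Qed.

Definition dr_unit (x : X) : G := exist _ (x, 0, x) (dr_triples_unit x).

Definition dr_inv (a : G) : G :=
  exist _ (dr_src a, - dr_deg a, dr_rng a) (dr_triples_inv a).

Definition dr_mul (a b : G) (e : dr_src a = dr_rng b) : G :=
  exist _ (dr_rng a, dr_deg a + dr_deg b, dr_src b) (dr_triples_mul e).

Lemma dr_ext (a b : G) : dr_rng a = dr_rng b -> dr_deg a = dr_deg b ->
  dr_src a = dr_src b -> a = b.
Proof.
move=> er ed es; apply: val_inj; move: er ed es.
by rewrite /dr_rng /dr_deg /dr_src; case: (val a) (val b) => [[? ?] ?] [[? ?] ?]
  /= -> -> ->.
Qed.

Definition dr_groupoid : groupoid X G.
Proof.
apply: (@Groupoid X G dr_rng dr_src dr_unit dr_inv dr_mul) => //.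
- by move=> a b c *; apply: dr_ext => //; rewrite /dr_deg /= addrA.
- by move=> a e; apply: dr_ext => //; rewrite /dr_deg /= add0r.
- by move=> a e; apply: dr_ext => //; rewrite /dr_deg /= addr0.
- by move=> a e; apply: dr_ext => //; rewrite /dr_deg /= addNr.
- by move=> a e; apply: dr_ext => //; rewrite /dr_deg /= addrN.
Defined.

End DeaconuRenault.

(* Main.v *)
Require Import Defs.
From mathcomp Require Import all_boot all_order all_algebra.
From mathcomp Require Import zify.
From mathcomp Require Import all_classical all_reals all_analysis.

(** Finiteness of [X] is compared with each algebraic condition separately.

    If [X] is infinite, then, being locally compact, Hausdorff and totally
    disconnected, it contains an infinite sequence [C 0, C 1, ...] of pairwise
    disjoint nonempty compact open sets ([infinite_disjoint_compact_opens]).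
    Their indicators, seen on the unit space of the groupoid, are linearly
    independent elements of degree [0], so the algebra is not locally finite
    ([dual_family_infinite_dim]). For the chain condition, let [I n] consist of
    the elements of the algebra supported on arrows with source in
    [C 0 `|` ... `|` C n.-1]. The source of a product is the source of its second
    factor, so [I n] is a left ideal, and the indicator of [C n] shows that the
    chain is strictly increasing ([left_noetherian_no_disjoint_units]). That
    [I n] is stable under multiplication presupposes that the algebra is closed
    under convolution, i.e. that products of compact open bisections are again
    compact open bisections. This holds as soon as products of open sets of
    arrows are open ([bisection_prod]), which for the groupoid at hand is
    checked on basic sets ([dr_prod_open]).

    If [X] is finite, it is discrete and an arrow is determined by its range,
    degree and source. Each degree then contains finitely many arrows, whence
    local finiteness. For the Noetherian property, inside one row (the arrows with a given range) order the
    arrows by degree, breaking ties arbitrarily, and let the type of an element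
    in that row be the range and source of its leading arrow. Two arrows [g0],
    [g] of the same type differ by the left factor [g g0^-1], an isotropy arrow,
    and convolution by its indicator shifts a row rigidly. Given an increasing
    chain of left ideals, choose for each of the finitely many types an element
    of the union whose row spans the narrowest range of degrees; all the choices
    lie in one ideal [I N]. Any element of the union can then be reduced to [0]
    by subtracting shifted multiples of the chosen elements: by minimality of
    the width, a reduction step lowers the leading arrow without creating lower
    degrees, so the process stops ([chain_reduction]). This is division with
    remainder for Laurent polynomials, with the width as Euclidean function.

    Finally, inversion of arrows induces an anti-automorphism of the algebra,
    which exchanges left and right ideals ([left_right_noetherian]). *)

Set Implicit Arguments.
Unset Strict Implicit.
Unset Printing Implicit Defensive.

Import Order.TTheory GRing.Theory Num.Theory.
Local Open Scope classical_set_scope.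
Local Open Scope ring_scope.

(** * Compact open sets in totally disconnected spaces *)

Section CompactOpen.
Variable T : topologicalType.
Hypothesis T_hausdorff : hausdorff_space T.

(** Otherwise the traces of the closures on [E] would generate a filter with a
    cluster point in [E], and that point would lie in all the closures. *)
Lemma compact_filter_avoid (E : set T) (F : set (set T)) : compact E ->
  Filter F -> (forall p, E p -> exists2 W, F W & ~ closure W p) ->
  exists2 W, F W & closure W `&` E = set0.
Proof.
move=> cE FF avoid; apply: contrapT => bad.
have meets W : F W -> (closure W `&` E) !=set0.
  by move=> FW; apply/set0P/eqP => W0; apply: bad; exists W.
pose H := filter_from F (fun W => closure W `&` E).
have HF : ProperFilter H.
  apply: filter_from_proper; last by move=> W /meets.
  apply: filter_from_filter; first by exists setT; exact: filterT.
  move=> V W FV FW; exists (V `&` W); first exact: filterI.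
  by move=> x [/closureI[? ?] ?].
have HE : H E by exists setT; [exact: filterT | move=> x []].
have [p [Ep clp]] := cE H HF HE.
have [W FW Wp] := avoid p Ep; apply: Wp.
rewrite (closure_id (closure W)).1; last exact: closed_closure.
by move=> V; apply: clp; exists W => // x [].
Qed.

Lemma hausdorff_disjoint_nbhs (p q : T) : p <> q ->
  exists U V : set T, [/\ nbhs p U, nbhs q V & U `&` V = set0].
Proof.
move=> pq; apply: contrapT => H; apply: pq; apply: T_hausdorff => U V pU qV.
by apply/set0P/eqP => UV; apply: H; exists U, V.
Qed.

(** Two applications of [compact_filter_avoid]: to the neighbourhoods of a point
    of [E] and the compact set [F], then to the neighbourhoods of [F] and the
    compact set [E]. *)
Lemma compact_separation (E F : set T) : compact E -> compact F ->
  E `&` F = set0 ->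
  exists W : set T, [/\ open W, F `<=` W & closure W `&` E = set0].
Proof.
move=> cE cF EF.
have point p : E p -> exists2 U, nbhs p U & closure U `&` F = set0.
  move=> Ep; apply: (compact_filter_avoid cF) => q Fq.
  have [|U [V [pU qV UV]]] := @hausdorff_disjoint_nbhs p q.
    by move=> pq; have : (E `&` F) p; [split; rewrite // pq | rewrite EF].
  by exists U => // /(_ V qV); rewrite UV; case.
pose G : set (set T) := [set W | F `<=` W^°].
have FG : Filter G.
  split; first by move=> x _; rewrite interiorT.
  - by move=> A B FA FB x Fx; rewrite interiorI; split; [exact: FA|exact: FB].
  - by move=> A B AB FA x /FA; exact: interiorS.
have [p Ep|W GW WE] := @compact_filter_avoid E G cE FG.
  have [U pU UF] := point p Ep.
  exists (~` closure U).
    move=> x Fx; rewrite (interior_id _).1 => [clU|].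
      by have : (closure U `&` F) x by []; rewrite UF.
    exact/closed_openC/closed_closure.
  move=> /(_ U pU)[x [+ Ux]]; apply; exact: subset_closure.
exists W^°; split=> //; first exact: open_interior.
rewrite -subset0 -WE; apply: setSI; apply: closureS; exact: interior_subset.
Qed.

(** The relatively clopen neighbourhoods of [x] in [K]: [K] is only a subset,
    so being open in [K] is phrased through the complement. *)
Definition clopen_in (K : set T) (x : T) : set (set T) :=
  [set C | [/\ C x, C `<=` K, closed C & closed (K `\` C)]].

Lemma clopen_in_shrink (K O : set T) x : compact K -> K x -> open O ->
  \bigcap_(C in clopen_in K x) C `<=` O ->
  exists2 C, clopen_in K x C & C `<=` O.
Proof.
move=> cK Kx oO QO; have clK := compact_closed T_hausdorff cK.
have FF : Filter (filter_from (clopen_in K x) id).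
  apply: filter_from_filter.
    by exists K; split=> //; rewrite setDv; exact: closed0.
  move=> A B [Ax AK cA cKA] [Bx BK cB cKB]; exists (A `&` B) => //.
  split=> //; first by move=> y [/AK].
    exact: closedI.
  by rewrite setDIr; exact: closedU.
have [||W [C CK CW] WE] :=
  @compact_filter_avoid (K `\` O) (filter_from (clopen_in K x) id) _ FF.
- by rewrite setDE; apply: compact_closedI => //; exact: open_closedC.
- move=> p [Kp Op]; have : ~ (\bigcap_(C in clopen_in K x) C) p by move=> /QO.
  move=> /existsNP[C] /not_implyP[CK Cp]; exists C; first by exists C.
  by case: CK => _ _ cC _; rewrite -(closure_id C).1.
exists C => // y Cy; apply: contrapT => Oy.
have : (closure W `&` (K `\` O)) y; last by rewrite WE.
split; first exact/subset_closure/CW.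
by split=> //; case: CK => _ /(_ y Cy).
Qed.

(** In a compact Hausdorff space quasi-components are connected. If the
    quasi-component of [x] were the union of disjoint closed parts [E] and [F]
    with [x] in [E], an open [W] around [F] whose closure misses [E] would cut a
    small enough clopen neighbourhood of [x] into two clopen pieces, and the
    piece containing [x] would exclude [F]. *)
Lemma clopen_in_component (K : set T) x : compact K -> K x ->
  connected (\bigcap_(C in clopen_in K x) C).
Proof.
move=> cK Kx; have clK := compact_closed T_hausdorff cK.
set Q := \bigcap_(C in _) C.
have KK : clopen_in K x K by split=> //; rewrite setDv; exact: closed0.
have cQ : closed Q by apply: closed_bigI => C [].
have QK : Q `<=` K by move=> y; exact.
have Qx : Q x by move=> C [].
(* The part containing [x] is cut out by a relatively clopen subset of [K]. *)
have part E F : closed E -> closed F -> Q = E `|` F -> E `&` F = set0 ->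
    E x -> F = set0.
  move=> cE cF QEF EF Ex.
  have kE : compact E.
    by apply: (subclosed_compact cE cK) => y Ey; apply: QK; rewrite QEF; left.
  have kF : compact F.
    apply: (subclosed_compact cF cK) => y Fy; apply: QK; rewrite QEF; by right.
  have [W [oW FW WE]] := compact_separation kE kF EF.
  have [||C [Cx CK cC cKC] CW] := @clopen_in_shrink K (W `|` ~` closure W) x cK Kx.
  - by apply: openU => //; exact/closed_openC/closed_closure.
  - rewrite -/Q QEF => y [Ey|/FW]; last by left.
    by right=> Wy; have : (closure W `&` E) y by []; rewrite WE.
  have CWE : C `&` W = C `&` closure W.
    apply/seteqP; split=> y [Cy Wy]; split=> //; first exact: subset_closure.
    by case: (CW y Cy).
  have : clopen_in K x (C `\` W).
    split=> //.
    - split=> // Wx; have : (closure W `&` E) x; last by rewrite WE.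
      by split=> //; exact: subset_closure.
    - by move=> y [/CK].
    - by rewrite setDE; apply: closedI => //; exact: open_closedC.
    - have -> : K `\` (C `\` W) = K `\` C `|` C `&` closure W.
        rewrite -CWE; apply/seteqP; split=> y.
          case=> Ky nCW; have [Cy|nCy] := pselect (C y); [right|by left].
          by split=> //; apply: contrapT => nW; exact: nCW.
        by move=> [[Ky nC]|[Cy Wy]]; split; [by []|by case|exact: CK|by case].
      apply: closedU => //; apply: closedI => //; exact: closed_closure.
  move=> CKW; rewrite -subset0 => y Fy.
  have Qy : Q y by rewrite QEF; right.
  by case: (Qy _ CKW) => _; apply; exact: FW.
move=> B B0 [C oC BC] [D cD BD].
have cB : closed B by rewrite BD; exact: closedI.
have cB' : closed (Q `\` B).
  by rewrite BC setDIr setDv set0U setDE; apply: closedI => //; exact: open_closedC.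
have BQ : B `<=` Q by rewrite BC => y [].
have BU : Q = B `|` (Q `\` B) by rewrite setDUK.
have BI : B `&` (Q `\` B) = set0 by rewrite setDIK.
case: (pselect (B x)) => Bx.
  by rewrite [RHS]BU (part _ _ cB cB' BU BI Bx) setU0.
have B0' : B = set0.
  by apply: (part (Q `\` B) B) => //; [rewrite setUC|rewrite setIC].
by case: B0 => y; rewrite B0'.
Qed.

Hypothesis T_lcpt : locally_compact [set: T].
Hypothesis T_td : totally_disconnected [set: T].

(** The quasi-component of [x] in a compact neighbourhood [K] is connected, hence
    reduced to [x], so some relatively clopen subset of [K] fits in [O] and in
    the interior of [K]; such a subset is open in the whole space. *)
Lemma compact_open_base (x : T) (O : set T) : open O -> O x ->
  exists U, [/\ compact U, open U, U x & U `<=` O].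
Proof.
move=> oO Ox.
have [K + [cK clK]] := T_lcpt (I : [set: T] x).
rewrite withinE => -[V xV]; rewrite !setIT => KV; rewrite -{V}KV in xV; move: xV => xK.
have Kx := nbhs_singleton xK.
have [||C [Cx CK cC cKC] CO] := @clopen_in_shrink K (O `&` K^°) x cK Kx.
- by apply: openI => //; exact: open_interior.
- have Qx : \bigcap_(C in clopen_in K x) C `<=` [set x].
    rewrite -(T_td (I : [set: T] x)); apply: connected_component_max => //.
      by move=> C [].
    exact: clopen_in_component.
  by move=> y /Qx ->.
exists C; split=> //; last by move=> y /CO[].
- exact: subclosed_compact cC cK CK.
- have -> : C = K^° `&` ~` (K `\` C).
    apply/seteqP; split=> y; first by move=> Cy; case: (CO y Cy) => _ ?; split=> // -[].
    by move=> [/interior_subset Ky] /not_andP[|/contrapT].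
  by apply: openI; [exact: open_interior|exact: closed_openC].
Qed.

(** Separate two points of [V] by a compact open set: one of the two pieces of
    [V] is infinite, and the other one is nonempty. *)
Lemma infinite_clopen_split (V : set T) : open V -> closed V ->
  infinite_set V -> exists W, [/\ open W, closed W, infinite_set W,
    W `<=` V & V `\` W !=set0].
Proof.
move=> oV cV iV; have [p Vp] := infinite_setN0 iV.
have [q [Vq pq]] := infinite_setN0 (infinite_setD iV (finite_set1 p)).
have [|//|U [cU oU Up UV]] := @compact_open_base p (V `\` [set q]).
  rewrite setDE; apply: openI => //; apply: closed_openC.
  by apply: compact_closed => //; exact: compact_set1.
  by split=> // qp; apply: pq; rewrite qp.
have UV' : U `<=` V by move=> y /UV[].
have clU := compact_closed T_hausdorff cU.
have [fU|iU] := pselect (finite_set U); last first.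
  by exists U; split=> //; exists q; split=> // /UV[_]; exact.
exists (V `\` U); split.
- by rewrite setDE; apply: openI => //; exact: closed_openC.
- by rewrite setDE; apply: closedI => //; exact: open_closedC.
- exact: infinite_setD.
- by move=> y [].
- by exists p; split=> // -[].
Qed.

(** Splitting repeatedly gives infinite clopen sets [V 0], [V 1], ..., each
    strictly contained in the previous one; [C n] is chosen in
    [V n `\` V n.+1]. *)
Lemma infinite_disjoint_compact_opens : infinite_set [set: T] ->
  exists C : nat -> set T, [/\ forall n, compact (C n), forall n, open (C n),
    forall n, C n !=set0 & forall m n, (m < n)%N -> C m `&` C n = set0].
Proof.
move=> iT.
pose P (V : set T) := [/\ open V, closed V & infinite_set V].
have step (V : {V | P V}) : exists W : {V | P V},
    sval W `<=` sval V /\ sval V `\` sval W !=set0.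
  case: V => V [oV cV iV]; have [W [oW cW iW WV VW]] := infinite_clopen_split oV cV iV.
  by exists (exist _ W (And3 oW cW iW)).
pose next V := sval (cid (step V)).
have PT : P setT by split; [exact: openT|exact: closedT|].
pose V n := iter n next (exist _ setT PT).
have nextP n : sval (V n.+1) `<=` sval (V n) /\ sval (V n) `\` sval (V n.+1) !=set0.
  exact: (svalP (cid (step (V n)))).
have mono m n : (m <= n)%N -> sval (V n) `<=` sval (V m).
  by move=> /subnK <-; elim: (n - m)%N => // k IH y /(nextP _).1; exact: IH.
have pick n : exists C, [/\ compact C, open C, C !=set0 &
    C `<=` sval (V n) `\` sval (V n.+1)].
  have [p Dp] := (nextP n).2.
  have [||C [cC oC Cp CD]] := @compact_open_base p (sval (V n) `\` sval (V n.+1)).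
  - case: (svalP (V n)) => oV _ _; case: (svalP (V n.+1)) => _ cV _.
    by rewrite setDE; apply: openI => //; exact: closed_openC.
  - by [].
  - by exists C; split=> //; exists p.
exists (fun n => sval (cid (pick n))); split=> [n|n|n|m n mn];
  try by case: (svalP (cid (pick n))).
rewrite -subset0 => y [].
case: (svalP (cid (pick m))) => _ _ _ Dm; case: (svalP (cid (pick n))) => _ _ _ Dn.
by move=> /Dm[_ +] /Dn[+ _] => + /(mono _ _ mn).
Qed.

End CompactOpen.

(** * Linear spans *)

Section LinearSpan.
Context (K : fieldType) (E : lmodType K).
Implicit Types S V : set E.

Lemma lspan_sub S : S `<=` lspan S.
Proof.
by move=> v Sv; exists 1%N, (fun=> 1), (fun=> v); rewrite big_ord1 scale1r.
Qed.

Lemma lspan0 S : lspan S 0.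
Proof. by exists 0%N, (fun=> 0), (fun=> 0); split=> [[]|]//; rewrite big_ord0. Qed.

Lemma lspanD S u v : lspan S u -> lspan S v -> lspan S (u + v).
Proof.
move=> [m [a [e [Se ->]]]] [n [b [d [Sd ->]]]].
exists (m + n)%N,
  (fun i : 'I_(m + n) => match fintype.split i with inl j => a j | inr j => b j end),
  (fun i : 'I_(m + n) => match fintype.split i with inl j => e j | inr j => d j end).
split; first by move=> i; case: (fintype.split i).
rewrite big_split_ord /=; congr (_ + _); apply: eq_bigr => i _.
  by rewrite (unsplitK (inl i)).
by rewrite (unsplitK (inr i)).
Qed.

Lemma lspanZ S k u : lspan S u -> lspan S (k *: u).
Proof.
move=> [m [a [e [Se ->]]]]; exists m, (fun i => k * a i), e; split=> //.
by rewrite scaler_sumr; apply: eq_bigr => i _; rewrite scalerA.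
Qed.

Lemma lspan_sumZ S n (a : 'I_n -> K) (v : 'I_n -> E) :
  (forall i, lspan S (v i)) -> lspan S (\sum_(i < n) a i *: v i).
Proof.
move=> Sv; apply: (big_ind (lspan S)); [exact: lspan0|exact: lspanD|].
by move=> i _; exact: lspanZ.
Qed.

Lemma lspanB S u v : lspan S u -> lspan S v -> lspan S (u - v).
Proof. by move=> Su Sv; apply: lspanD => //; rewrite -scaleN1r; exact: lspanZ. Qed.

Lemma lspan_ind S (P : E -> Prop) : P 0 ->
  (forall u v, P u -> P v -> P (u + v)) -> (forall k u, S u -> P (k *: u)) ->
  lspan S `<=` P.
Proof.
by move=> P0 PD PS _ [n [a [e [Se ->]]]]; apply: (big_ind P) => // i _; exact: PS.
Qed.

End LinearSpan.

(** A finite spanning set with [N] elements cannot span all coordinate vectors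
    of [K^(N+1)]: compare ranks after evaluating at the points [g i]. *)
Lemma dual_family_infinite_dim (K : fieldType) (G : Type) (V : set (G -> K^o))
    (e : nat -> G -> K^o) (g : nat -> G) :
  (forall i, V (e i)) -> (forall i j, e i (g j) = (i == j)%:R) ->
  ~ finite_dimensional V.
Proof.
move=> Ve eg [B /finite_seqP[s Bs] VB].
pose ev (f : G -> K^o) : 'rV[K]_(size s).+1 := \row_j f (g j).
pose M : 'M[K]_(size s, (size s).+1) := \matrix_i ev (nth 0 s i).
have evM : lspan B `<=` [set f | (ev f <= M)%MS].
  apply: lspan_ind => /=.
  - suff -> : ev 0 = 0 by exact: sub0mx.
    by apply/rowP => j; rewrite !mxE.
  - move=> u v uM vM; suff -> : ev (u + v) = ev u + ev v by exact: addmx_sub.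
    by apply/rowP => j; rewrite !mxE.
  - move=> k u; rewrite Bs /= => su.
    have -> : ev (k *: u) = k *: ev u by apply/rowP => j; rewrite !mxE.
    apply: scalemx_sub.
    have lt : (index u s < size s)%N by rewrite index_mem.
    have -> : ev u = row (Ordinal lt) M by rewrite rowK /= nth_index.
    exact: row_sub.
have : (1%:M <= M)%MS.
  apply/row_subP => i; have := evM (e i); rewrite -VB => /(_ (Ve i)) /=.
  congr (_ <= _)%MS; apply/rowP => j; rewrite !mxE eg.
  by rewrite -val_eqE.
by move=> /mxrankS; rewrite mxrank1 => /leq_trans/(_ (rank_leq_row _)); rewrite ltnn.
Qed.

(** * The partial product of a groupoid as a relation *)

Section GroupoidRelation.
Context {X G : Type} (gG : groupoid X G).
Local Notation r := (grng gG).
Local Notation s := (gsrc gG).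
Local Notation inv := (ginv gG).
Local Notation unit := (gunit gG).

(** Stating that [c] is the product of [a] and [b] as a relation avoids carrying
    the composability proof that the product depends on. *)
Definition gprod (a b c : G) := exists e : s a = r b, gmul e = c.

Lemma gprod_fun a b c c' : gprod a b c -> gprod a b c' -> c = c'.
Proof. by move=> [e <-] [e' <-]; rewrite (Prop_irrelevance e e'). Qed.

Lemma gprod_ex a b : s a = r b -> exists c, gprod a b c.
Proof. by move=> e; exists (gmul e), e. Qed.

Lemma gprod_mid a b c : gprod a b c -> s a = r b.
Proof. by case. Qed.

Lemma gprod_rng a b c : gprod a b c -> r c = r a.
Proof. by move=> [e <-]; rewrite grng_mul. Qed.

Lemma gprod_src a b c : gprod a b c -> s c = s b.
Proof. by move=> [e <-]; rewrite gsrc_mul. Qed.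

Lemma gprodA a b c ab bc d :
  gprod a b ab -> gprod b c bc -> gprod ab c d -> gprod a bc d.
Proof.
move=> [e <-] [e' <-] [e1 <-].
have e2 : s a = r (gmul e') by rewrite grng_mul.
by exists e2; exact/esym/gmulA.
Qed.

Lemma gprodA' a b c ab bc d :
  gprod a b ab -> gprod b c bc -> gprod a bc d -> gprod ab c d.
Proof.
move=> [e <-] [e' <-] [e2 <-].
have e1 : s (gmul e) = r c by rewrite gsrc_mul.
by exists e1; exact: gmulA.
Qed.

Lemma gprod1l a : gprod (unit (r a)) a a.
Proof. by exists (gsrc_unit gG (r a)); exact: gmul1. Qed.

Lemma gprod1r a : gprod a (unit (s a)) a.
Proof. by exists (esym (grng_unit gG (s a))); exact: gmulx1. Qed.

Lemma gprodVl a : gprod (inv a) a (unit (s a)).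
Proof. by exists (gsrc_inv gG a); exact: gmulV. Qed.

Lemma gprodVr a : gprod a (inv a) (unit (r a)).
Proof. by exists (esym (grng_inv gG a)); exact: gmulxV. Qed.

Lemma gprod_divl a b c : gprod a b c -> gprod (inv a) c b.
Proof.
move=> abc; apply: (gprodA (gprodVl a) abc).
by rewrite (gprod_mid abc); exact: gprod1l.
Qed.

Lemma gprod_divr a b c : gprod a b c -> gprod c (inv b) a.
Proof.
move=> abc; apply: (gprodA' abc (gprodVr b)).
by rewrite -(gprod_mid abc); exact: gprod1r.
Qed.

Lemma ginvK : involutive inv.
Proof.
move=> a; apply: gprod_fun (gprod_divl (gprodVl a)).
by have := gprod1r (inv (inv a)); rewrite gsrc_inv grng_inv.
Qed.

Lemma gprod_inv a b c : gprod a b c -> gprod (inv b) (inv a) (inv c).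
Proof. by move=> /gprod_divl /gprod_divr /gprod_divl. Qed.

Lemma gprod_solvel a c : r a = r c -> exists b, gprod a b c.
Proof.
move=> e; have [|b ib] := @gprod_ex (inv a) c; first by rewrite gsrc_inv.
by exists b; rewrite -[a]ginvK; exact: gprod_divl.
Qed.

Lemma gprod_solver b c : s b = s c -> exists a, gprod a b c.
Proof.
move=> e; have [|a ia] := @gprod_ex c (inv b); first by rewrite grng_inv.
by exists a; rewrite -[b]ginvK; exact: gprod_divr.
Qed.

Lemma gprod_funr a b b' c : gprod a b c -> gprod a b' c -> b = b'.
Proof. by move=> /gprod_divl + /gprod_divl; exact: gprod_fun. Qed.

Definition gprod_set (U V : set G) : set G :=
  [set c | exists a b, [/\ U a, V b & gprod a b c]].

End GroupoidRelation.

(** * Convolution *)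

Section Convolution.
Context (K : fieldType) {X : Type} {G : topologicalType} (gG : groupoid X G).
Local Notation r := (grng gG).
Local Notation s := (gsrc gG).
Local Notation comp := (gprod gG).
Local Notation conv := (@convolution K X G gG).
Implicit Types (U V : set G) (f g : G -> K^o).

Local Notation ind U := (\1_U : G -> K^o).

Lemma sum_funE n (F : 'I_n -> G -> K^o) c : (\sum_i F i) c = \sum_i F i c.
Proof. by rewrite fct_sumE. Qed.

Lemma convE f g c :
  conv f g c = \sum_(p \in [set p | comp p.1 p.2 c]) (f p.1 * g p.2).
Proof. by []. Qed.

(** Convolving by the indicator of a bisection [U] moves values along [U]: at most
    one element [u] of [U] can be the left factor of [c], and the value at [c]
    is read off at [u^-1 c] (or is [0] if there is no such [u]). *)
Lemma conv_indic_in U g u b c : set_inj U r -> U u -> comp u b c ->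
  conv (ind U) g c = g b.
Proof.
move=> Uinj Uu ubc; rewrite convE -(@fsbig_widen _ _ _ _ [set (u, b)]) /=.
- by rewrite fsbig_set1 /= indicE mem_set // mul1r.
- by move=> _ ->.
- move=> [u' b'] /= [/= ubc' ne]; rewrite indicE.
  have [U'|] := boolP (u' \in U); last by rewrite mul0r.
  case: ne; have uu : u' = u.
    by apply: Uinj => //; [exact/mem_set|rewrite -(gprod_rng ubc') (gprod_rng ubc)].
  by rewrite uu in ubc' *; rewrite (gprod_funr ubc' ubc).
Qed.

Lemma conv_indic_out U g c : (forall u, U u -> r u <> r c) ->
  conv (ind U) g c = 0.
Proof.
move=> Uc; rewrite convE fsbig1 // => -[u b] /= ubc; rewrite indicE.
have [/set_mem U'|] := boolP (u \in U); last by rewrite mul0r.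
by case: (Uc u U'); rewrite (gprod_rng ubc).
Qed.

Lemma conv_indic_sumr U n (a : 'I_n -> K) (g : 'I_n -> G -> K^o) :
  set_inj U r ->
  conv (ind U) (\sum_i a i *: g i) = \sum_i a i *: conv (ind U) (g i).
Proof.
move=> Uinj; apply/funext => c; rewrite [RHS]sum_funE.
have [[u Uu uc]|H] := pselect (exists2 u, U u & r u = r c).
  have [b ubc] := gprod_solvel uc.
  rewrite (conv_indic_in _ Uinj Uu ubc) sum_funE; apply: eq_bigr => i _.
  exact: (congr1 (fun z : K => a i * z) (esym (conv_indic_in (g i) Uinj Uu ubc))).
have out u : U u -> r u <> r c by move=> Uu uc; apply: H; exists u.
rewrite conv_indic_out // big1 // => i _.
exact: (etrans (congr1 (fun z : K => a i * z) (conv_indic_out (g i) out)) (mulr0 _)).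
Qed.

(** Linearity in the left argument is not automatic, since the convolution sum
    is over an infinite set of factorisations of [c]. But each bisection [U i]
    contains the left factor of at most one of them, so all the sums may be
    taken over one finite set. *)
Lemma conv_suml n (a : 'I_n -> K) (U : 'I_n -> set G) g :
  (forall i, set_inj (U i) r) ->
  conv (\sum_i a i *: ind (U i)) g = \sum_i a i *: conv (ind (U i)) g.
Proof.
move=> Uinj; apply/funext => c; rewrite [RHS]sum_funE.
pose P i : set (G * G) := [set p | comp p.1 p.2 c /\ U i p.1].
pose D : set (G * G) := \bigcup_(i in [set: 'I_n]) P i.
have fD : finite_set D.
  apply: bigcup_finite => // i _.
  have [[p Pp]|nP] := pselect (exists p, P i p).
    apply: (@sub_finite_set _ _ [set p]); last exact: finite_set1.
    move=> [u b] [/= ubc Uu]; case: p Pp => u' b' [/= ubc' Uu'].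
    have uu : u = u'.
      apply: (Uinj i); rewrite ?inE //.
      by rewrite -(gprod_rng ubc) (gprod_rng ubc').
    by rewrite uu in ubc *; rewrite (gprod_funr ubc ubc').
  by apply: (@sub_finite_set _ _ set0) => // p Pp; case: nP; exists p.
have DS : D `<=` [set p | comp p.1 p.2 c] by move=> p [i _ []].
have out i p : ~ D p -> comp p.1 p.2 c -> ind (U i) p.1 = 0.
  move=> nD pc; rewrite indicE; case: (boolP (p.1 \in U i)) => // /set_mem Ui.
  by case: nD; exists i.
rewrite convE -(fsbig_widen _ _ _ DS); last first.
  move=> p [/= pc nD]; rewrite sum_funE big1 ?mul0r // => i _.
  by rewrite scalrfctE out // scaler0.
rewrite fsbig_finite //=.
transitivity (\sum_(i < n) \sum_(p <- finmap.enum_fset (fset_set D))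
  a i * (ind (U i) p.1 * g p.2)).
  rewrite exchange_big /=; apply: eq_bigr => p _; rewrite sum_funE mulr_suml.
  by apply: eq_bigr => i _; rewrite mulrA.
apply: eq_bigr => i _; rewrite -mulr_sumr; congr (_ * _).
rewrite [RHS]convE -(fsbig_widen _ _ _ DS) ?fsbig_finite //.
by move=> p [/= pc nD]; rewrite /= out // mul0r.
Qed.

End Convolution.

(** * Ideals of the Steinberg algebra *)

Section Algebra.
Context (K : fieldType) {X : Type} {G : topologicalType} (gG : groupoid X G).
Local Notation r := (grng gG).
Local Notation s := (gsrc gG).
Local Notation inv := (ginv gG).
Local Notation comp := (gprod gG).
Local Notation A := (@steinberg_algebra K X G gG).
Local Notation conv := (@convolution K X G gG).
Local Notation cob := (compact_open_bisection gG).
Implicit Types (U V : set G) (f g : G -> K^o).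
Local Notation ind U := (\1_U : G -> K^o).

Lemma steinberg_indic U : cob U -> A (ind U).
Proof. by move=> bU; apply: lspan_sub; exists U. Qed.

(** Choosing the bisections in a presentation of an element. *)
Lemma steinbergP f : A f -> exists n (a : 'I_n -> K) (U : 'I_n -> set G),
  (forall i, cob (U i)) /\ f = \sum_i a i *: ind (U i).
Proof.
move=> [n [a [e [ce ->]]]].
have /choice[U UP] i : exists U, cob U /\ ind U = e i by case: (ce i) => U; exists U.
exists n, a, U; split=> [i|]; first by case: (UP i).
by apply: eq_bigr => i _; case: (UP i) => _ ->.
Qed.

Lemma conv_indic_indic U V : set_inj U r -> 
  conv (ind U) (ind V) = ind (gprod_set gG U V).
Proof.
move=> Ur; apply/funext => c; rewrite [RHS]indicE.
have [[u Uu uc]|H] := pselect (exists2 u, U u & r u = r c); last first.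
  rewrite conv_indic_out; last by move=> u Uu uc; apply: H; exists u.
  case: (boolP (c \in _)) => // /set_mem[u [v [Uu Vv uvc]]].
  by case: H; exists u => //; rewrite (gprod_rng uvc).
have [b ubc] := gprod_solvel uc.
rewrite (conv_indic_in _ Ur Uu ubc) indicE; congr ((nat_of_bool _)%:R).
apply/idP/idP => [/set_mem Vb|/set_mem[u' [b' [Uu' Vb' ubc']]]]; apply/mem_set.
  by exists u, b.
have uu : u = u'.
  by apply: Ur; rewrite ?inE // -(gprod_rng ubc) (gprod_rng ubc').
by rewrite uu in ubc; rewrite (gprod_funr ubc ubc').
Qed.

Section Closed.
Hypothesis cob_prod : forall U V, cob U -> cob V -> cob (gprod_set gG U V).

Lemma steinberg_conv f g : A f -> A g -> A (conv f g).
Proof.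
move=> /steinbergP[m [a [U [bU ->]]]] /steinbergP[n [b [V [bV ->]]]].
rewrite conv_suml => [|i]; last by case: (bU i).
apply: lspan_sumZ => i; have [_ _ Ur _] := bU i.
rewrite conv_indic_sumr //; apply: lspan_sumZ => j.
by rewrite conv_indic_indic //; apply/steinberg_indic/cob_prod.
Qed.

(** The elements supported over a set [F] of sources form a left ideal, because
    a product has the source of its second factor. *)
Lemma source_support_ideal (F : set X) :
  left_ideal A conv [set f | A f /\ forall a, f a != 0 -> F (s a)].
Proof.
split.
- by move=> f [].
- by split=> [|a]; [exact: lspan0|rewrite eqxx].
- move=> f g [Af Ff] [Ag Fg]; split; first exact: lspanB.
  move=> a; have [fa|/Ff//] := eqVneq (f a) 0.
  have [ga|/Fg//] := eqVneq (g a) 0.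
  by rewrite (_ : (f - g) a = f a - g a) // fa ga subrr eqxx.
- move=> f g Af [Ag Fg]; split; first exact: steinberg_conv.
  move=> c; apply: contraNP => Fc; apply/eqP; rewrite convE fsbig1 // => -[a b] /= abc.
  have [->|/Fg] := eqVneq (g b) 0; first by rewrite mulr0.
  by rewrite -(gprod_src abc).
Qed.

(** The ideals attached to the unions of the first [n] sets [C i] form a strictly
    increasing chain. *)
Lemma left_noetherian_no_disjoint_units (C : nat -> set X) :
  (forall n, A (ind (gunit gG @` C n))) -> (forall n, C n !=set0) ->
  (forall m n, (m < n)%N -> C m `&` C n = set0) ->
  ~ left_noetherian A conv.
Proof.
move=> AC C0 Cdisj noeth.
pose F n : set X := \bigcup_(i in [set i | (i < n)%N]) C i.
pose I n := [set f | A f /\ forall a, f a != 0 -> F n (s a)].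
have [n||N HN] := noeth I; first exact: source_support_ideal.
  move=> n f [Af Ff]; split=> // a /Ff[i /= lt Ci]; exists i => //=.
  exact: ltnW.
have : I N.+1 (ind (gunit gG @` C N)).
  split=> // a; rewrite indicE.
  have [/set_mem[x Cx <-] _|] := boolP (a \in _); last by rewrite eqxx.
  by rewrite gsrc_unit; exists N => //=.
rewrite HN // => -[_]; have [x Cx] := C0 N.
move=> /(_ (gunit gG x)); rewrite indicE mem_set; last by exists x.
rewrite oner_eq0 gsrc_unit => /(_ isT)[i /= lt Ci].
by have : (C i `&` C N) x by []; rewrite Cdisj.
Qed.

End Closed.

Section Involution.
Hypothesis cob_inv : forall U, cob U -> cob (inv @^-1` U).

(** Inversion of arrows acts on functions as an anti-automorphism of order two. *)
Definition star f : G -> K^o := f \o inv.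

Lemma starK : involutive star.
Proof. by move=> f; apply/funext => c; rewrite /star /= ginvK. Qed.

Lemma steinberg_star f : A f -> A (star f).
Proof.
move=> /steinbergP[n [a [U [bU ->]]]].
rewrite (_ : star _ = \sum_i a i *: ind (inv @^-1` U i)).
  by apply: lspan_sumZ => i; apply/steinberg_indic/cob_inv.
by apply/funext => c; rewrite /star /= !sum_funE.
Qed.

Lemma conv_star f g : conv (star f) (star g) = star (conv g f).
Proof.
apply/funext => c; rewrite /star /= !convE.
rewrite [RHS](@reindex_fsbig _ _ _ _ _ (fun p => (inv p.2, inv p.1))
   [set p | comp p.1 p.2 c]) /=.
  by apply: eq_fsbigr => -[a b] _ /=; rewrite mulrC.
split=> [[a b] /= abc|[a b] [a' b'] _ _ /= [e1 e2]|[a b] /= abc].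
- exact: gprod_inv.
- by rewrite (can_inj (@ginvK _ _ gG) e1) (can_inj (@ginvK _ _ gG) e2).
exists (inv b, inv a); last by rewrite /= !ginvK.
by rewrite /= -[c](@ginvK _ _ gG); exact: gprod_inv.
Qed.

Lemma right_ideal_star (I : set (G -> K^o)) : right_ideal A conv I ->
  left_ideal A conv (star @^-1` I).
Proof.
move=> [IA I0 IB IM]; split=> /=.
- by move=> f /IA /steinberg_star; rewrite starK.
- by rewrite (_ : star 0 = 0).
- by move=> f g If Ig; rewrite (_ : star (f - g) = star f - star g) //; exact: IB.
- by move=> f g /steinberg_star Af Ig; rewrite -conv_star; exact: IM.
Qed.

Lemma left_ideal_star (I : set (G -> K^o)) : left_ideal A conv I ->
  right_ideal A conv (star @^-1` I).
Proof.
move=> [IA I0 IB IM]; split=> /=.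
- by move=> f /IA /steinberg_star; rewrite starK.
- by rewrite (_ : star 0 = 0).
- by move=> f g If Ig; rewrite (_ : star (f - g) = star f - star g) //; exact: IB.
- by move=> f g Ig /steinberg_star Af; rewrite -conv_star; exact: IM.
Qed.

Lemma acc_star (P Q : set (set (G -> K^o))) :
  (forall I, Q I -> P (star @^-1` I)) ->
  ascending_chain_condition P -> ascending_chain_condition Q.
Proof.
move=> QP acc I IQ Imono.
have [n|n f /=|N HN] := acc (fun n => star @^-1` I n); first exact/QP/IQ.
  exact: Imono.
exists N => n /HN e; apply/funext => f.
by have := congr1 (fun J => J (star f)) e; rewrite /preimage /mkset /= starK.
Qed.

Lemma left_right_noetherian :
  left_noetherian A conv <-> right_noetherian A conv.
Proof.
by split; apply: acc_star; [exact: right_ideal_star|exact: left_ideal_star].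
Qed.

End Involution.

End Algebra.

(** * Finite unit spaces *)

Section FiniteUnits.
Context (K : fieldType) {X : choiceType} {G : topologicalType} (gG : groupoid X G).
Local Notation r := (grng gG).
Local Notation s := (gsrc gG).
Local Notation comp := (gprod gG).
Local Notation A := (@steinberg_algebra K X G gG).
Local Notation conv := (@convolution K X G gG).
Local Notation cob := (compact_open_bisection gG).
Local Notation ind U := (\1_U : G -> K^o).
Variable deg : G -> int.
Hypothesis deg_prod : forall a b c, comp a b c -> deg c = deg a + deg b.
Hypothesis arrow_ext : forall a b, r a = r b -> deg a = deg b -> s a = s b -> a = b.
Hypothesis cob1 : forall a, cob [set a].
Hypothesis finX : finite_set [set: X].

(** A bisection has at most as many elements as there are units, so the elements
    of the algebra have finite support. *)
Lemma steinberg_degree_bounded f : A f -> exists B : nat,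
  forall h, f h != 0 -> `|deg h| <= B%:Z.
Proof.
move: f; apply: lspan_ind => [|u v [B uB] [C vC]|k u [U [_ _ Ur _] <-]].
- by exists 0%N => h; rewrite eqxx.
- exists (maxn B C) => h uvh; have [uh|/uB] := eqVneq (u h) 0; last lia.
  have [vh|/vC] := eqVneq (v h) 0; last lia.
  by move: uvh; rewrite (_ : (u + v) h = u h + v h) // uh vh addr0 eqxx.
- have [S US] : exists S : seq G, U = [set` S].
    apply/finite_seqP; have <- := eq_finite_set (inj_card_eq Ur).
    exact: sub_finite_set finX.
  exists (\max_(h <- S) `|deg h|%N) => h; rewrite scalrfctE indicE.
  have [/set_mem|] := boolP (h \in U); last by rewrite scaler0 eqxx.
  rewrite US /= => hS _.
  by rewrite -abszE lez_nat; exact: (leq_bigmax_seq h).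
Qed.

Lemma finite_index_maps : exists (idx : X * X -> nat) (M : nat),
  injective idx /\ forall p, (idx p < M)%N.
Proof.
have /finite_seqP[S XS] : finite_set [set: X * X].
  by rewrite -setXTT; exact: finite_setX.
have inS p : p \in S by have : [set` S] p by rewrite -XS.
exists (index^~ S), (size S); split=> [p q|p]; last by rewrite index_mem.
by move=> e; rewrite -(nth_index p (inS p)) e nth_index.
Qed.

Section Reduction.
Variables (idx : X * X -> nat) (M : nat).
Hypothesis idx_inj : injective idx.
Hypothesis idx_lt : forall p, (idx p < M)%N.

(** The lexicographic order by degree and then by range and source, encoded as
    an integer. Arrows [h] and [t h] with [t] an isotropy arrow have the same
    range and source, so multiplication by [t] shifts ranks by the constant
    [deg t * M]. *)
Definition rank (h : G) : int := deg h * M%:Z + (idx (r h, s h))%:Z.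

Lemma rank_inj g h : rank g = rank h -> g = h.
Proof.
rewrite /rank => e; have lg := idx_lt (r g, s g); have lh := idx_lt (r h, s h).
have ed : deg g = deg h by nia.
have /idx_inj[er es] : idx (r g, s g) = idx (r h, s h) by rewrite ed in e; lia.
exact: arrow_ext.
Qed.

(** Only the row of [g] is constrained: convolution by the indicator of an isotropy
    arrow at the range of [g] erases the other rows. The integer [a] is any
    lower bound for the degrees in the row, so [deg g - a] bounds the width. *)
Definition leading_in_row (a : int) (g : G) (f : G -> K^o) :=
  f g != 0 /\ forall h, f h != 0 -> r h = r g -> a <= deg h /\ rank h <= rank g.

Variable I : nat -> set (G -> K^o).
Hypothesis I_ideal : forall n, left_ideal A conv (I n).
Hypothesis I_mono : forall n, I n `<=` I n.+1.

Lemma chain_mono m n : (m <= n)%N -> I m `<=` I n.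
Proof.
by move=> /subnK <-; elim: (n - m)%N => // k IH f /IH; exact: I_mono.
Qed.

(** A well-founded choice: among all elements of the union of the chain with
    leading arrow of type [p], take one of least width. *)
Lemma narrowest_of_type (p : X * X) : exists N, forall n f g a,
  I n f -> leading_in_row a g f -> (r g, s g) = p ->
  exists f0 g0 a0, [/\ I N f0, leading_in_row a0 g0 f0, (r g0, s g0) = p
    & deg g0 - a0 <= deg g - a].
Proof.
pose Q w := exists n f g a, [/\ I n f, leading_in_row a g f, (r g, s g) = p
  & deg g - a = w%:Z].
have QE n f g a : I n f -> leading_in_row a g f -> (r g, s g) = p ->
    exists2 w, Q w & deg g - a = w%:Z.
  move=> If Lf gp; have [_ /(_ g) H] := Lf.
  have [//|//|ag _] := H; first by case: Lf.
  by exists `|deg g - a|%N; [exists n, f, g, a; split=> //|]; lia.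
have [exQ|nQ] := pselect (exists w, `[< Q w >]); last first.
  exists 0%N => n f g a If Lf gp; have [w Qw _] := QE _ _ _ _ If Lf gp.
  by case: nQ; exists w; exact/asboolP.
case: (ex_minnP exQ) => w0 /asboolP[N [f0 [g0 [a0 [If0 Lf0 gp0 e0]]]]] w0_min.
exists N => n f g a If Lf gp; exists f0, g0, a0; split=> //.
have [w Qw e] := QE _ _ _ _ If Lf gp.
by rewrite e0 e lez_nat; apply/w0_min/asboolP.
Qed.

Lemma narrowest_of_each_type : exists N, forall n f g a,
  I n f -> leading_in_row a g f ->
  exists f0 g0 a0, [/\ I N f0, leading_in_row a0 g0 f0, r g0 = r g, s g0 = s g
    & deg g0 - a0 <= deg g - a].
Proof.
have /choice[N NP] := narrowest_of_type.
have /finite_seqP[S XS] : finite_set [set: X * X].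
  by rewrite -setXTT; exact: finite_setX.
exists (\max_(p <- S) N p) => n f g a If Lf.
have [f0 [g0 [a0 [If0 Lf0 [er es] w]]]] := NP (r g, s g) _ _ _ _ If Lf erefl.
exists f0, g0, a0; split=> //; apply: chain_mono If0.
apply: leq_bigmax_seq => //.
by have : [set` S] (r g, s g) by rewrite -XS.
Qed.

(** Induction on the number [k] of ranks available above degree [a]. If the top
    rank is attained by [f] at [g], shift the element [f0] of [I N] of the same
    type so that its leading arrow becomes [g], and cancel. Since [f0] is at
    most as wide as [f], the shifted copy has no degree below [a]. *)
Lemma chain_reduction (N : nat) :
  (forall n f g a, I n f -> leading_in_row a g f ->
    exists f0 g0 a0, [/\ I N f0, leading_in_row a0 g0 f0, r g0 = r g, s g0 = s g
      & deg g0 - a0 <= deg g - a]) ->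
  forall (k n : nat) f a, I n f ->
    (forall h, f h != 0 -> a <= deg h /\ rank h < a * M%:Z + k%:Z) -> I N f.
Proof.
move=> HN; elim=> [|k IH] n f a If fb.
  suff -> : f = 0 by case: (I_ideal N).
  apply/funext => h; apply/eqP; apply: contraT => /fb[ah].
  by rewrite /rank; nia.
have [[g [fg rg]]|no] := pselect (exists g, f g != 0 /\ rank g = a * M%:Z + k%:Z);
  last first.
  apply: (IH n f a If) => h fh; have [ah rh] := fb h fh; split=> //.
  have : rank h <> a * M%:Z + k%:Z by move=> rh'; apply: no; exists h.
  lia.
have Lf : leading_in_row a g f.
  by split=> // h /fb[ah rh] _; split=> //; rewrite rg; lia.
have [f0 [g0 [a0 [If0 [f0g0 Lf0] er es wle]]]] := HN n f g a If Lf.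
(* [t] is the isotropy arrow [g g0^-1]. *)
have [t tg] := gprod_solver es.
have dt := deg_prod tg.
pose c : K := f g / f0 g0.
pose f1 : G -> K^o := conv (c *: (ind [set t])) f0.
have At : A (c *: ind [set t]) by exact/lspanZ/steinberg_indic.
have f1E : f1 = c *: conv (ind [set t]) f0.
  have [_ _ tr _] := cob1 t.
  have := @conv_suml K X G gG 1 (fun=> c) (fun=> [set t]) f0 (fun=> tr).
  by rewrite !big_ord1.
have tr : set_inj [set t] r by case: (cob1 t).
have f1_prod b h : comp t b h -> f1 h = c * f0 b.
  by move=> tbh; rewrite f1E scalrfctE (conv_indic_in _ tr (erefl : [set t] t) tbh).
have f1_out h : r h <> r t -> f1 h = 0.
  move=> th; rewrite f1E scalrfctE conv_indic_out ?scaler0 //.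
  by move=> _ -> /esym.
have If1 m : (N <= m)%N -> I m f1.
  move=> Nm; case: (I_ideal m) => _ _ _; apply => //.
  exact: chain_mono If0.
pose m := maxn n N.
have IBm : I m (f - f1).
  case: (I_ideal m) => _ _ IB _; apply: IB; last by apply: If1; exact: leq_maxr.
  by apply: chain_mono If; exact: leq_maxl.
have If' : I N (f - f1).
  apply: (IH m _ a IBm) => h; rewrite (_ : (f - f1) h = f h - f1 h) // => fh.
  have hg : h <> g.
    move=> hg; move: fh; rewrite hg (f1_prod _ _ tg) /c divfK ?subrr ?eqxx //.
  suff [ah rh] : a <= deg h /\ rank h <= rank g.
    split=> //; have : rank h <> rank g by move=> /rank_inj.
    rewrite rg in rh *; lia.
  have [fh0|/fb[ah rh]] := eqVneq (f h) 0; last by split=> //; rewrite rg; lia.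
  have [rht|/f1_out f1h] := pselect (r h = r t); last first.
    by move: fh; rewrite fh0 f1h subrr eqxx.
  have [b tbh] := gprod_solvel (esym rht).
  have [f0b|f0b] := eqVneq (f0 b) 0.
    by move: fh; rewrite fh0 (f1_prod _ _ tbh) f0b mulr0 subrr eqxx.
  have rb : r b = r g0 by rewrite -(gprod_mid tbh) (gprod_mid tg).
  have [ab rkb] := Lf0 b f0b rb.
  have dh := deg_prod tbh.
  split; first lia.
  move: rkb; rewrite /rank (gprod_rng tbh) (gprod_rng tg) (gprod_src tbh) es.
  have rt : r t = r g0 by rewrite -(gprod_rng tg) er.
  by rewrite rt rb dh dt; nia.
case: (I_ideal N) => _ I0 IB _.
(* Ideals are only assumed stable under subtraction. *)
rewrite (_ : f = (f - f1) - (0 - f1)); last by rewrite sub0r opprK subrK.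
by apply: (IB) => //; apply: (IB) => //; exact: If1.
Qed.

End Reduction.

Theorem finite_units_left_noetherian : left_noetherian A conv.
Proof.
move=> I I_ideal I_mono.
have [idx [M [idx_inj idx_lt]]] := finite_index_maps.
have [N HN] := narrowest_of_each_type idx M I_mono.
exists N => n Nn; apply/seteqP; split; last exact: chain_mono.
have [IA _ _ _] := I_ideal n.
move=> f If; have [B fB] := steinberg_degree_bounded (IA f If).
(* Degrees between [- B] and [B] leave [B.*2.+1 * M] possible ranks. *)
apply: (chain_reduction idx_inj idx_lt I_ideal I_mono HN
  (k := (B.*2.+1 * M)%N) (a := - B%:Z) If).
move=> h /fB hB; split; first lia.
have := idx_lt (r h, s h); rewrite /rank; nia.
Qed.

End FiniteUnits.

(** * Products and inverses of compact open bisections *)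

Lemma open_local (T : topologicalType) (O : set T) :
  (forall x, O x -> exists B, [/\ open B, B x & B `<=` O]) -> open O.
Proof.
move=> H; rewrite openE => x /H[B [oB Bx BO]]; rewrite /interior nbhsE.
by exists B.
Qed.

Section BisectionProduct.
Context {X G : topologicalType} (gG : groupoid X G).
Local Notation r := (grng gG).
Local Notation s := (gsrc gG).
Local Notation inv := (ginv gG).
Local Notation comp := (gprod gG).
Local Notation cob := (compact_open_bisection gG).
Hypothesis X_hausdorff : hausdorff_space X.
Hypothesis r_cont : continuous r.
Hypothesis s_cont : continuous s.
Hypothesis inv_cont : continuous inv.
Hypothesis prod_open : forall U V : set G, open U -> open V -> open (gprod_set gG U V).

Lemma bisection_inv (U : set G) : cob U -> cob (inv @^-1` U).
Proof.
move=> [cU oU rU sU]; split.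
- suff -> : inv @^-1` U = inv @` U.
    by apply: continuous_compact => //; exact: continuous_subspaceT.
  apply/seteqP; split=> [a Ua|_ [a Ua <-]]; last by rewrite /= ginvK.
  by exists (inv a) => //; rewrite ginvK.
- by move/continuousP : inv_cont; apply.
- move=> a b /set_mem Ua /set_mem Ub e; apply: (can_inj (@ginvK _ _ gG)).
  by apply: sU; [exact/mem_set|exact/mem_set|rewrite !gsrc_inv].
- move=> a b /set_mem Ua /set_mem Ub e; apply: (can_inj (@ginvK _ _ gG)).
  by apply: rU; [exact/mem_set|exact/mem_set|rewrite !grng_inv].
Qed.

(** Compactness is the only delicate point. Let [U'] be the set of [a] in [U] with
    source in the range of [V]; it is compact because the range of [V] is
    compact, hence closed. The product set is the image of [U'] under the map
    [phi] sending [a] to [a b], where [b] is the unique element of [V] composable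
    with [a]. This map is continuous: on [U'], the preimage of an open set [O]
    is the product of [O] with the inverse of [V]. *)
Lemma bisection_prod (U V : set G) : cob U -> cob V -> cob (gprod_set gG U V).
Proof.
move=> [cU oU rU sU] [cV oV rV sV]; split; last 2 first.
- move=> c c' /set_mem[a [b [Ua Vb abc]]] /set_mem[a' [b' [Ua' Vb' abc']]] e.
  have aa : a = a'.
    by apply: rU; [exact/mem_set|exact/mem_set|rewrite -(gprod_rng abc) e (gprod_rng abc')].
  have bb : b = b'.
    by apply: rV; [exact/mem_set|exact/mem_set|rewrite -(gprod_mid abc) aa (gprod_mid abc')].
  by rewrite aa bb in abc; exact: gprod_fun abc abc'.
- move=> c c' /set_mem[a [b [Ua Vb abc]]] /set_mem[a' [b' [Ua' Vb' abc']]] e.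
  have bb : b = b'.
    by apply: sV; [exact/mem_set|exact/mem_set|rewrite -(gprod_src abc) e (gprod_src abc')].
  have aa : a = a'.
    by apply: sU; [exact/mem_set|exact/mem_set|rewrite (gprod_mid abc) bb -(gprod_mid abc')].
  by rewrite aa bb in abc; exact: gprod_fun abc abc'.
- pose U' := U `&` s @^-1` (r @` V).
  have cU' : compact U'.
    apply: compact_closedI => //; apply: closed_comp => //.
    apply: compact_closed => //; apply: continuous_compact => //.
    exact: continuous_subspaceT.
  have /choice[phi phiP] a : exists c, U' a -> exists2 b, V b & comp a b c.
    have [[Ua [b Vb ba]]|] := pselect (U' a); last by exists a.
    by have [c abc] := gprod_ex (esym ba); exists c => _; exists b.
  have -> : gprod_set gG U V = phi @` U'.
    apply/seteqP; split=> [c [a [b [Ua Vb abc]]]|_ [a U'a <-]].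
      have U'a : U' a by split=> //; exists b => //; rewrite (gprod_mid abc).
      exists a => //; have [b' Vb' abc'] := phiP a U'a.
      have bb : b = b'.
        by apply: rV; [exact/mem_set|exact/mem_set|rewrite -(gprod_mid abc) (gprod_mid abc')].
      by rewrite bb in abc; exact: gprod_fun abc' abc.
    by have [b Vb abc] := phiP a U'a; exists a, b; case: U'a.
  apply: continuous_compact => //; apply/continuousP => O oO.
  apply/open_subspaceP; exists (gprod_set gG O (inv @^-1` V)).
    by apply: prod_open => //; move/continuousP : inv_cont; apply.
  apply/seteqP; split=> a [Oa U'a]; split=> //; have [b Vb abc] := phiP a U'a.
    case: Oa => c [b' [Oc /= Vb' cba]].
    have acb := gprod_divr cba; change (O (phi a)).
    have bb : b = inv b'.
      by apply: rV; [exact/mem_set|exact/mem_set|rewrite -(gprod_mid abc) (gprod_mid acb)].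
    by rewrite bb in abc; rewrite (gprod_fun abc acb).
  exists (phi a), (inv b); split=> //=; first by rewrite ginvK.
  exact: gprod_divr.
- exact: prod_open.
Qed.

End BisectionProduct.

(** * The topology of the Deaconu-Renault groupoid *)

Section DRTopology.
Context {X : topologicalType} (S : dr_system X).
Local Notation sigma := (dr_map S).
Local Notation dom := (dr_dom_iter S).
Local Notation G := (dr_groupoid_type S).

Lemma local_homeo_cont (W O : set X) : open W -> W `<=` dr_dom S -> open O ->
  open (W `&` sigma @^-1` O).
Proof.
move=> oW WD oO; apply: open_local => x [Wx Ox].
have [U [oU Ux UD oUs [cU _]]] := dr_map_local_homeo (WD x Wx).
exists (W `&` (U `&` sigma @^-1` O)); split; [|by []|by move=> y [Wy []]].
apply: openI => //; move: cU; rewrite continuous_open_subspace //.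
by move/(continuous_inP _ oU); exact.
Qed.

Lemma local_homeo_open (W : set X) : open W -> W `<=` dr_dom S ->
  open (sigma @` W).
Proof.
move=> oW WD; apply: open_local => _ [x Wx <-].
have [U [oU Ux UD oUs [cU [g cg gK]]]] := dr_map_local_homeo (WD x Wx).
have gx y : U y -> g (sigma y) = y by move=> Uy; apply: gK; exact: mem_set.
exists (sigma @` U `&` g @^-1` (U `&` W)); split.
- move: cg; rewrite continuous_open_subspace //.
  by move/(continuous_inP _ oUs); apply; exact: openI.
- by split; [exists x|rewrite /preimage /= gx].
- by move=> _ [[y Uy <-]]; rewrite /preimage /= gx // => -[_ Wy]; exists y.
Qed.

Lemma iter_dom_open_cont n : open (dom n) /\ forall W O : set X, open W ->
  W `<=` dom n -> open O -> open (W `&` iter n sigma @^-1` O).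
Proof.
elim: n => [|n [oD IH]]; first by split=> [|W O oW _ oO]; [exact: openT|exact: openI].
have oD' : open (dom n.+1).
  by apply: (IH _ (dr_dom S) oD) => //; exact: dr_dom_open.
split=> // W O oW WD oO.
rewrite (_ : _ `&` _ = W `&` iter n sigma @^-1` (dr_dom S `&` sigma @^-1` O)).
  apply: IH => //; first by move=> x /WD[].
  by apply: local_homeo_cont => //; exact: dr_dom_open.
by apply/seteqP; split=> x [Wx]; [split=> //; split=> //; case: (WD x Wx)|case].
Qed.

Lemma iter_dom_open n : open (dom n). Proof. by case: (iter_dom_open_cont n). Qed.

Lemma iter_cont n (W O : set X) : open W -> W `<=` dom n -> open O ->
  open (W `&` iter n sigma @^-1` O).
Proof. by case: (iter_dom_open_cont n) => _; exact. Qed.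

Lemma iter_open n (W : set X) : open W -> W `<=` dom n ->
  open (iter n sigma @` W).
Proof.
elim: n => [|n IH] oW WD; first by rewrite image_id.
rewrite (_ : _ @` _ = sigma @` (iter n sigma @` W)); last by rewrite image_comp.
apply: local_homeo_open; first by apply: IH => // x /WD[].
by move=> _ [x /WD[_ ?] <-].
Qed.

(** Since iterates of [dr_map S] are continuous and open, an injective restriction
    to an open set is automatically a homeomorphism onto its image; see
    [injective_openP]. *)
Definition injective_open n (U : set X) :=
  [/\ open U, U `<=` dom n & set_inj U (iter n sigma)].

Lemma injective_open_sub n U V : injective_open n U -> open V -> V `<=` U ->
  injective_open n V.
Proof.
move=> [oU UD Ui] oV VU; split=> //; first by move=> x /VU /UD.
by move=> x y /set_mem /VU Ux /set_mem /VU Uy; apply: Ui; exact: mem_set.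
Qed.

Lemma injective_open_ex n x : dom n x -> exists2 U, injective_open n U & U x.
Proof.
elim: n => [_|n IH [Dx Dn]].
  by exists setT => //; split; [exact: openT|exact: subsetT|move=> ? ? _ _].
have [U [oU UD Ui] Ux] := IH Dx.
have [V [oV Vx VD _ [_ [g _ gK]]]] := dr_map_local_homeo Dn.
exists (U `&` iter n sigma @^-1` V) => //; split; first exact: iter_cont.
  by move=> y [/UD Dy /VD].
move=> y z /set_mem[Uy Vy] /set_mem[Uz Vz] /= e.
apply: Ui; [exact: mem_set|exact: mem_set|].
by rewrite -[LHS]gK ?e ?gK //; exact: mem_set.
Qed.

Lemma injective_openP n (U : set X) :
  [/\ open U, U `<=` dom n & homeo_onto_image U (iter n sigma)] <->
  injective_open n U.
Proof.
split=> [[oU UD [_ [g _ gK]]]|[oU UD Ui]]; split=> //.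
  by move=> x y Ux Uy e; rewrite -(gK x Ux) e gK.
split.
  rewrite continuous_open_subspace //; apply/(continuous_inP _ oU) => O oO.
  exact: iter_cont.
have /choice[g gP] y : exists x,
    (iter n sigma @` U) y -> U x /\ iter n sigma x = y.
  by have [[x Ux xy]|] := pselect ((iter n sigma @` U) y); [exists x|exists y].
have gK x : U x -> g (iter n sigma x) = x.
  move=> Ux; have [|Ug e] := gP (iter n sigma x); first by exists x.
  by apply: Ui => //; exact: mem_set.
exists g; last by move=> x /set_mem; exact: gK.
have oI : open (iter n sigma @` U) by exact: iter_open.
rewrite continuous_open_subspace //; apply/(continuous_inP _ oI) => O oO.
rewrite (_ : _ `&` _ = iter n sigma @` (U `&` O)).
  by apply: iter_open => [|x []]; [exact: openI|move=> /UD].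
apply/seteqP; split=> [_ [[x Ux <-]]|_ [x [Ux Ox] <-]].
  by rewrite /preimage /= gK // => Ox; exists x.
by split; [exists x|rewrite /preimage /= gK].
Qed.

Lemma dr_basic_open (B : set G) : dr_basic_sets B -> open B.
Proof.
move=> BB; exists [set B]; last by rewrite bigcup_set1.
by move=> _ ->; exact: finI_from1.
Qed.

Lemma dr_basicP (B : set G) : dr_basic_sets B <-> exists U V m n,
  [/\ injective_open m U, injective_open n V & B = dr_basic_set U m n V].
Proof.
by split=> -[U [V [m [n [/injective_openP ? /injective_openP ? ->]]]]]; exists U, V, m, n.
Qed.

Lemma dr_arrow (a : G) : exists m n, [/\ dr_deg a = m%:Z - n%:Z, dom m (dr_rng a),
  dom n (dr_src a) & iter m sigma (dr_rng a) = iter n sigma (dr_src a)].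
Proof. exact: (set_mem (valP a)). Qed.

Lemma dr_arrow_ex m n x y : dom m x -> dom n y ->
  iter m sigma x = iter n sigma y -> exists a : G,
  [/\ dr_rng a = x, dr_deg a = m%:Z - n%:Z & dr_src a = y].
Proof.
move=> Dx Dy e; have t : (x, m%:Z - n%:Z, y) \in dr_triples S.
  by apply: mem_set; exists m, n.
by exists (exist _ (x, m%:Z - n%:Z, y) t : G).
Qed.

Lemma dr_basic_set_open (U V : set X) m n : open U -> open V ->
  U `<=` dom m -> V `<=` dom n -> open (dr_basic_set (S := S) U m n V).
Proof.
move=> oU oV UD VD; apply: open_local => a [Ua Va da ea].
have [U' iU U'a] := injective_open_ex (UD _ Ua).
have [V' iV V'a] := injective_open_ex (VD _ Va).
exists (dr_basic_set (U `&` U') m n (V `&` V')); split.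
- apply/dr_basic_open/dr_basicP; exists (U `&` U'), (V `&` V'), m, n; split=> //.
    by apply: (injective_open_sub iU) => [|x []//]; apply: openI => //; case: iU.
  by apply: (injective_open_sub iV) => [|x []//]; apply: openI => //; case: iV.
- by split.
- by move=> b [[Ub _] [Vb _] db eb].
Qed.

(** Both sets contain [a], so [m - n = m' - n']. If [m <= m'], the equation
    defining the first set implies the one defining the second, because the
    latter is obtained by applying the same iterate to both sides. *)
Lemma dr_basic_setI (B C : set G) a : dr_basic_sets B -> dr_basic_sets C ->
  B a -> C a -> exists D, [/\ dr_basic_sets D, D a & D `<=` B `&` C].
Proof.
move=> /dr_basicP[U [V [m [n [iU iV ->]]]]] /dr_basicP[U' [V' [m' [n' [iU' iV' ->]]]]].
move: m n m' n' U V U' V' iU iV iU' iV'.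
suff wl m n m' n' U V U' V' : injective_open m U -> injective_open n V ->
    injective_open m' U' -> injective_open n' V' -> (m <= m')%N ->
    dr_basic_set U m n V a -> dr_basic_set U' m' n' V' a ->
    exists D : set G, [/\ dr_basic_sets D, D a &
      D `<=` dr_basic_set U m n V `&` dr_basic_set U' m' n' V'].
  move=> m n m' n' U V U' V' iU iV iU' iV' Ba Ca.
  have [/wl|/ltnW /wl] := leqP m m'.
    by move/(_ _ _ U V U' V'); exact.
  move/(_ _ _ U' V' U V iU' iV' iU iV Ca Ba) => [D [bD Da DBC]].
  by exists D; split=> //; rewrite setIC.
move=> iU iV [oU' _ _] [oV' _ _] mm' [Ua Va da ea] [U'a V'a da' ea'].
have nn' : (n <= n')%N by lia.
exists (dr_basic_set (U `&` U') m n (V `&` V')); split.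
- apply/dr_basicP; exists (U `&` U'), (V `&` V'), m, n; split=> //.
    by apply: (injective_open_sub iU) => [|x []//]; apply: openI => //; case: (iU).
  by apply: (injective_open_sub iV) => [|x []//]; apply: openI => //; case: (iV).
- by split.
- move=> b [[Ub U'b] [Vb V'b] db eb]; split; split=> //; first by rewrite db -da.
  have e : (m' - m = n' - n)%N by lia.
  by rewrite -(subnK mm') -(subnK nn') !iterD eb e.
Qed.

Lemma dr_basic_seq (t : seq (set G)) a :
  (forall E, E \in t -> dr_basic_sets E /\ E a) ->
  exists B, [/\ dr_basic_sets B, B a & forall E, E \in t -> B `<=` E].
Proof.
elim: t => [_|E t IH H].
  have [m [n [da Dx Dy e]]] := dr_arrow a.
  have [U iU Ux] := @injective_open_ex m _ Dx.
  have [V iV Vy] := @injective_open_ex n _ Dy.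
  exists (dr_basic_set U m n V); split; [|by split|by []].
  by apply/dr_basicP; exists U, V, m, n.
have [F Ft|B [bB Ba BF]] := IH; first by apply: H; rewrite inE Ft orbT.
have [bE Ea] := H E (mem_head _ _).
have [D [bD Da DBE]] := dr_basic_setI bB bE Ba Ea.
exists D; split=> // F; rewrite inE => /orP[/eqP ->|/BF BF']; first by move=> b /DBE[].
by move=> b /DBE[/BF'].
Qed.

Lemma dr_base (O : set G) a : open O -> O a ->
  exists B, [/\ dr_basic_sets B, B a & B `<=` O].
Proof.
move=> [D DfinI <-] [C DC Ca].
have [s ss sC] := DfinI _ DC.
rewrite -sC in Ca.
have [E sE|B [bB Ba BE]] := @dr_basic_seq (finmap.enum_fset s) a.
  by split; [exact/set_mem/ss|exact: Ca].
exists B; split=> // b Bb; have Cb : C b by rewrite -sC => E /= sE; exact: BE Bb.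
by exists C.
Qed.

Lemma dr_rng_continuous : continuous (@dr_rng X S).
Proof.
apply/continuousP => O oO; apply: open_local => a Oa.
have [m [n [da Dx Dy e]]] := dr_arrow a.
exists (dr_basic_set (O `&` dom m) m n (dom n)); split.
- apply: dr_basic_set_open => //; last exact: iter_dom_open.
  by apply: openI => //; exact: iter_dom_open.
- by split.
- by move=> b [[]].
Qed.

Lemma dr_inv_continuous : continuous (@dr_inv X S).
Proof.
apply/continuousP => O oO; apply: open_local => a Oa.
have [B [/dr_basicP[U [V [m [n [[oU UD _] [oV VD _] ->]]]]]]] := dr_base oO Oa.
move=> [Ua Va da ea] BO; exists (dr_basic_set V n m U); split.
- exact: dr_basic_set_open.
- by have {}da : - dr_deg a = m%:Z - n%:Z := da; split=> //; lia.
- move=> b [Vb Ub db eb]; apply: (BO (dr_inv b)); split=> //.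
  by rewrite (_ : dr_deg _ = - dr_deg b) // db; lia.
Qed.

Lemma dr_src_continuous : continuous (@dr_src X S).
Proof.
apply/continuousP => O oO.
rewrite (_ : _ @^-1` _ = @dr_inv X S @^-1` (@dr_rng X S @^-1` O)) //.
have /continuousP := dr_inv_continuous; apply.
by have /continuousP := dr_rng_continuous; apply.
Qed.

Lemma dr_unit_continuous : continuous (dr_unit S).
Proof.
apply/continuousP => O oO; apply: open_local => x Ox.
have [B [/dr_basicP[U [V [m [n [[oU _ _] [oV _ _] ->]]]]]]] := dr_base oO Ox.
move=> [Ux Vx dx _] BO; exists (U `&` V); split=> //; first exact: openI.
move=> y [Uy Vy]; apply: BO; split=> //.
by have {}dx : 0 = m%:Z - n%:Z := dx; rewrite (_ : m = n) //; lia.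
Qed.

Lemma dr_gprodP (a b c : G) : gprod (dr_groupoid S) a b c <->
  [/\ dr_src a = dr_rng b, dr_rng c = dr_rng a, dr_src c = dr_src b
    & dr_deg c = dr_deg a + dr_deg b].
Proof.
split=> [[e <-]|[e er es ed]]; first by split.
by exists e; apply: dr_ext; rewrite ?er ?es ?ed.
Qed.

(** Let [a] be in [Z(A,m,n,B)], [b] in [Z(C,k,l,D)] and [c = a b]. If [n <= k], a
    neighbourhood of [c] in the product consists of the arrows
    [(x, m + (k - n) - l, z)] of level [(m + (k - n), l)] with [x] in [A], [z] in
    [D], and [sigma^m x = sigma^n y] for some [y] in [B `&` C]: applying
    [sigma^(k - n)] gives [sigma^k y = sigma^l z], so that the arrow factors
    through [y]. The condition on [x] is open as [sigma^n] is an open map. The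
    case [k <= n] is symmetric, with the intermediate point obtained from [z]. *)
Lemma dr_prod_open (O1 O2 : set G) : open O1 -> open O2 ->
  open (gprod_set (dr_groupoid S) O1 O2).
Proof.
move=> oO1 oO2; apply: open_local => c [a [b [Oa Ob abc]]].
have [ab cr cs cd] := (dr_gprodP a b c).1 abc.
have [B1 [/dr_basicP[A [B [m [n [[oA AD _] [oB BD _] ->]]]]]]] := dr_base oO1 Oa.
have [B2 [/dr_basicP[C [D [k [l [[oC CD _] [oD DD _] ->]]]]]]] := dr_base oO2 Ob.
move=> [Cb Db db eb] BO2 [Aa Ba da ea] BO1.
have oBC : open (B `&` C) by exact: openI.
have Bb : (B `&` C) (dr_rng b) by split=> //; rewrite -ab.
have mid x z y : A x -> D z -> (B `&` C) y -> iter m sigma x = iter n sigma y ->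
    iter k sigma y = iter l sigma z -> forall c', dr_rng c' = x -> dr_src c' = z ->
    dr_deg c' = m%:Z - n%:Z + (k%:Z - l%:Z) -> gprod_set (dr_groupoid S) O1 O2 c'.
  move=> Ax Dz [By Cy] exy eyz c' cx cz cd'.
  have [a' [a'r a'd a's]] := dr_arrow_ex (AD x Ax) (BD y By) exy.
  have [b' [b'r b'd b's]] := dr_arrow_ex (CD y Cy) (DD z Dz) eyz.
  exists a', b'; split.
  - by apply: BO1; split; rewrite ?a'r ?a's.
  - by apply: BO2; split; rewrite ?b'r ?b's.
  - by apply/dr_gprodP; rewrite a'r a's b'r b's a'd b'd.
have [nk|/ltnW kn] := leqP n k.
- exists (dr_basic_set (A `&` iter m sigma @^-1` (iter n sigma @` (B `&` C)))
    (k - n + m) l D); split.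
  + apply: dr_basic_set_open => //.
      by apply: iter_cont => //; apply: iter_open => // y [/BD].
    move=> x [Ax [y [By Cy] exy]]; rewrite addnC; apply/dr_dom_iterD.
    split; first exact: AD.
    by rewrite -exy; have [] := (dr_dom_iterD S n (k - n) y).1; rewrite ?subnKC //; exact: CD.
  + split.
    * by rewrite cr; split=> //; exists (dr_rng b) => //; rewrite -ab.
    * by rewrite cs.
    * by rewrite cd da db; lia.
    * by rewrite cr cs iterD ea ab -iterD subnK.
  + move=> c' [[Ac [y BCy exy]] Dc dc ec]; apply: (mid _ _ y Ac Dc) => //.
      by rewrite -ec iterD -exy -iterD subnK.
    by rewrite dc; lia.
- exists (dr_basic_set A m (n - k + l)
    (D `&` iter l sigma @^-1` (iter k sigma @` (B `&` C)))); split.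
  + apply: dr_basic_set_open => //.
      by apply: iter_cont => //; apply: iter_open => // y [_ /CD].
    move=> x [Dx [y [By Cy] exy]]; rewrite addnC; apply/dr_dom_iterD.
    split; first exact: DD.
    by rewrite -exy; have [] := (dr_dom_iterD S k (n - k) y).1; rewrite ?subnKC //; exact: BD.
  + split.
    * by rewrite cr.
    * by rewrite cs; split=> //; exists (dr_rng b).
    * by rewrite cd da db; lia.
    * by rewrite cr cs iterD ea ab -eb -iterD subnK.
  + move=> c' [Ac [Dc [y BCy exy]] dc ec]; apply: (mid _ _ y Ac Dc) => //.
      by rewrite ec iterD -exy -iterD subnK.
    by rewrite dc; lia.
Qed.

End DRTopology.

(** A subset of a finite set is selected from an enumeration by a bit mask. *)
Lemma finite_subsets (T : eqType) (D : set T) : finite_set D ->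
  finite_set [set U : set T | U `<=` D].
Proof.
move=> /finite_seqP[t ->].
pose h (m : (size t).-tuple bool) : set T := [set` mask m t].
apply: (@sub_finite_set _ _ (range h)); last exact/finite_image/finite_finset.
move=> U Ut; exists (map_tuple (fun x => `[< U x >]) (in_tuple t)) => //.
rewrite /h /= -filter_mask; apply/seteqP; split=> x /=.
  by rewrite mem_filter => /andP[/asboolP].
by move=> Ux; rewrite mem_filter; apply/andP; split; [exact/asboolP|exact: Ut].
Qed.

(** * Finiteness conditions on Deaconu-Renault systems *)

Section DRSteinberg.
Context (K : fieldType) {X : topologicalType} (S : dr_system X).
Local Notation G := (dr_groupoid_type S).
Local Notation gG := (dr_groupoid S).
Local Notation cob := (compact_open_bisection gG).
Local Notation ind U := (\1_U : G -> K^o).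

Lemma finite_locally_finite : finite_set [set: X] ->
  steinberg_locally_finite K gG (@dr_deg X S).
Proof.
move=> fX k; exists [set ind U | U in
   [set U | cob U /\ U `<=` [set a | @dr_deg X S a = k]]] => //.
apply: finite_image; have fD : finite_set [set a | @dr_deg X S a = k].
  have inj : set_inj [set a | @dr_deg X S a = k] (fun a => (dr_rng a, dr_src a)).
    by move=> a b /set_mem/= da /set_mem/= db [er es]; apply: dr_ext => //; rewrite da.
  rewrite -(eq_finite_set (inj_card_eq inj)).
  apply: (@sub_finite_set _ _ setT) => //.
  by rewrite -setXTT; exact: finite_setX.
by apply: (sub_finite_set _ (finite_subsets fD)) => U [].
Qed.

Lemma finite_discrete (x : X) : finite_set [set: X] -> open [set x].
Proof.
move=> fX; rewrite -[X in open X]setCK; apply: closed_openC.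
apply: (compact_closed (dr_hausdorff S)); apply: finite_compact.
exact: (sub_finite_set _ fX).
Qed.

Lemma finite_singleton_bisection (a : G) : finite_set [set: X] -> cob [set a].
Proof.
move=> fX; split; [exact: compact_set1| |by move=> x y /set_mem -> /set_mem ->..].
have [m [n [da Dx Dy e]]] := dr_arrow a.
rewrite (_ : [set a] = dr_basic_set [set dr_rng a] m n [set dr_src a]).
  apply: dr_basic_set_open; [exact: finite_discrete|exact: finite_discrete|by move=> _ ->..].
apply/seteqP; split=> [_ ->|b [br bs bd _]]; first by split.
by apply: dr_ext => //; rewrite bd da.
Qed.

Lemma unit_bisection (C : set X) : compact C -> open C -> cob (gunit gG @` C).
Proof.
move=> cC oC; split.
- by apply: continuous_compact => //; apply: continuous_subspaceT; exact: dr_unit_continuous.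
- rewrite (_ : _ @` _ = dr_basic_set C 0 0 C).
    by apply: dr_basic_set_open.
  apply/seteqP; split=> [_ [x Cx <-]|a [Ca _ da e]]; first by split.
  by exists (dr_rng a) => //; apply: dr_ext => //; rewrite da.
- by move=> _ _ /set_mem[x _ <-] /set_mem[y _ <-]; rewrite !grng_unit => ->.
- by move=> _ _ /set_mem[x _ <-] /set_mem[y _ <-]; rewrite !gsrc_unit => ->.
Qed.

Lemma dr_bisection_prod U V : cob U -> cob V -> cob (gprod_set gG U V).
Proof.
apply: bisection_prod; [exact: dr_hausdorff S|exact: dr_rng_continuous|
  exact: dr_src_continuous|exact: dr_inv_continuous|exact: dr_prod_open].
Qed.

Lemma dr_bisection_inv U : cob U -> cob (ginv gG @^-1` U).
Proof. by apply: bisection_inv; exact: dr_inv_continuous. Qed.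

Lemma finite_left_noetherian : finite_set [set: X] ->
  steinberg_left_noetherian K gG.
Proof.
move=> fX; apply: (@finite_units_left_noetherian K X _ gG (@dr_deg X S)) => //.
- by move=> a b c /dr_gprodP[].
- exact: dr_ext.
- by move=> a; exact: finite_singleton_bisection.
Qed.

Hypothesis X_td : totally_disconnected [set: X].

Lemma locally_finite_finite : steinberg_locally_finite K gG (@dr_deg X S) ->
  finite_set [set: X].
Proof.
move=> lf; apply: contrapT => iX.
have [C [cC oC C0 Cdisj]] :=
  infinite_disjoint_compact_opens (dr_hausdorff S) (dr_locally_compact S) X_td iX.
have /choice[x Cx] : forall n, exists x, C n x by exact: C0.
have := lf 0; apply: (@dual_family_infinite_dim K G _
  (fun n => ind (gunit gG @` C n)) (fun n => dr_unit S (x n))).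
  move=> n; apply: lspan_sub; exists (gunit gG @` C n) => //.
  by split; [exact: unit_bisection|move=> _ [y _ <-]].
move=> i j; rewrite indicE; congr ((nat_of_bool _)%:R).
apply/idP/eqP => [/set_mem[y Ciy /(congr1 (@dr_rng X S)) /= yx]|->]; last first.
  by apply/mem_set; exists (x j).
have {}yx : y = x j := yx.
have Cij : C i (x j) by rewrite -yx.
have disj m n : (m < n)%N -> C m (x j) -> C n (x j) -> False.
  by move=> mn Cm Cn; have : (C m `&` C n) (x j) by []; rewrite Cdisj.
by case: (ltngtP i j) => // [ij|ji]; [case: (disj i j)|case: (disj j i)].
Qed.

Lemma left_noetherian_finite : steinberg_left_noetherian K gG ->
  finite_set [set: X].
Proof.
move=> noeth; apply: contrapT => iX.
have [C [cC oC C0 Cdisj]] :=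
  infinite_disjoint_compact_opens (dr_hausdorff S) (dr_locally_compact S) X_td iX.
apply: (left_noetherian_no_disjoint_units dr_bisection_prod _ C0 Cdisj noeth) => n.
by apply/steinberg_indic/unit_bisection.
Qed.

End DRSteinberg.

Theorem proposition6p9 (K : fieldType) (X : topologicalType) (S : dr_system X)
    (X_td : totally_disconnected [set: X]) :
  [<-> finite_set [set: X];
       steinberg_locally_finite K (dr_groupoid S) (@dr_deg X S);
       steinberg_left_noetherian K (dr_groupoid S);
       steinberg_right_noetherian K (dr_groupoid S)].
Proof.
have LR := left_right_noetherian K (@dr_bisection_inv X S).
tfae.
- exact: finite_locally_finite.
- by move=> /(locally_finite_finite X_td); exact: finite_left_noetherian.
- by move=> /LR.
- by move=> /LR; exact: left_noetherian_finite.
Qed.
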